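(* Let $q$ be a prime power, $r\ge 2$ an integer, and $u$ a positive integer with $u \mid \frac{q^r-1}{q-1}$. Let $\mathcal{X}_u=\{P_1,\dots,P_n\}$ be the set of rational points of the extended norm-trace curve over $\mathbb{F}_{q^r}$, let $\mathcal{M}\subseteq\Delta\left(x^{(q-1)u+1},y^{q^{r-1}}\right)$ be a set of monomials closed under divisibility, and let $\mathrm{ev}(\mathcal{M})$ be the corresponding decreasing norm-trace code. If the equation $x^2=u$ has a solution $\alpha$ in $\mathbb{F}_{q^r}$, then $$\mathrm{Hull}(\boldsymbol{\lambda}\cdot\mathrm{ev}(\mathcal{M}))=\boldsymbol{\lambda}\cdot\mathrm{ev}\left(\mathcal{M}\cap\mathcal{M}^\complement\right),$$ where $\boldsymbol{\lambda}=(\lambda_1,\dots,\lambda_n)$ with $\lambda_i:=\alpha^{-1}$ if the $x$-coordinate of $P_i$ is nonzero, and $\lambda_i:=1$ otherwise.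
   Context: Let $Tr(y)=y^{q^{r-1}}+y^{q^{r-2}}+\cdots+y^q+y$. The set of rational points of the (affine) extended norm-trace curve is $\mathcal{X}_u=\{(\alpha,\beta)\in\mathbb{F}_{q^r}^2:\alpha^u=Tr(\beta)\}$. The evaluation map is $\mathrm{ev}:\mathbb{F}_{q^r}[x,y]\to\mathbb{F}_{q^r}^n$, $f\mapsto(f(P_1),\dots,f(P_n))$. A set $\mathcal{M}$ of monomials in $x,y$ is closed under divisibility if $M\in\mathcal{M}$ and $M'\mid M$ imply $M'\in\mathcal{M}$. For a set $\mathcal{M}$ of monomials, $\mathrm{ev}(\mathcal{M})$ denotes the image under $\mathrm{ev}$ of the $\mathbb{F}_{q^r}$-span of $\mathcal{M}$; it is called a decreasing norm-trace code when $\mathcal{M}$ is closed under divisibility. $\Delta(x^i,y^j)$ denotes the set of monomials in $x,y$ that are multiples of neither $x^i$ nor $y^j$. The complement of $\mathcal{M}$ is $$\mathcal{M}^\complement:=\left\{\frac{x^{(q-1)u}y^{q^{r-1}-1}}{x^iy^j} : x^iy^j\in\Delta\left(x^{(q-1)u+1},y^{q^{r-1}}\right)\setminus\mathcal{M}\right\}.$$ For $\boldsymbol{\lambda}\in\mathbb{F}_{q^r}^n$ and a code $C\subseteq\mathbb{F}_{q^r}^n$, $\boldsymbol{\lambda}\cdot C=\{(\lambda_1c_1,\dots,\lambda_nc_n):(c_1,\dots,c_n)\in C\}$. The hull of a linear code $C$ is $\mathrm{Hull}(C)=C\cap C^\perp$, with the dual taken with respect to the standard (Euclidean) bilinear form.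 The integer $u$ is viewed as an element of $\mathbb{F}_q\subseteq\mathbb{F}_{q^r}$ (it is nonzero there). *)

(* Defs.v *)
From HB Require Import structures.
From mathcomp Require Import all_boot all_order all_algebra.
From mathcomp Require Import mpoly.
From mathcomp Require Import classical_sets.

Set Implicit Arguments.
Unset Strict Implicit.
Unset Printing Implicit Defensive.

Import GRing.Theory.
Local Open Scope ring_scope.
Local Open Scope classical_set_scope.

Definition prime_power (q : nat) : Prop :=
  exists p k : nat, [/\ prime p, (0 < k)%N & q = (p ^ k)%N].

(* A monomial x^i y^j is represented by its exponent vector in 'X_{1..2};
   divisibility of monomials is then the pointwise order (_ <= _)%MM. *)
Definition mon (i j : nat) : 'X_{1..2} := [multinom [tuple i; j]].

Definition div_closed (M : set 'X_{1..2}) : Prop :=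
  forall m m' : 'X_{1..2}, M m -> (m' <= m)%MM -> M m'.

Definition Delta (i j : nat) : set 'X_{1..2} :=
  [set m | ~~ (mon i 0 <= m)%MM /\ ~~ (mon 0 j <= m)%MM].

(* The subtraction of exponents is never truncated here: every monomial of
   Delta divides the top monomial x^{(q-1)u} y^{q^{r-1}-1}. *)
Definition mcompl (q r u : nat) (M : set 'X_{1..2}) : set 'X_{1..2} :=
  [set (mon ((q - 1) * u) (q ^ (r - 1) - 1) - m)%MM
     | m in Delta ((q - 1) * u + 1) (q ^ (r - 1)) `\` M].

Section Codes.
Variable F : fieldType.

Definition trace_poly (q r : nat) (y : F) : F := \sum_(k < r) y ^+ (q ^ k).

Definition norm_trace_points (q r u : nat) : set (F * F) :=
  [set P | P.1 ^+ u = trace_poly q r P.2].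

Definition mspan (M : set 'X_{1..2}) : set {mpoly F[2]} :=
  [set f | exists (s : seq 'X_{1..2}) (c : 'X_{1..2} -> F),
     (forall m, m \in s -> M m) /\ f = \sum_(m <- s) c m *: 'X_[m]].

Definition ev (n : nat) (P : n.-tuple (F * F)) (f : {mpoly F[2]}) : 'rV[F]_n :=
  \row_i f.@[tnth [tuple (tnth P i).1; (tnth P i).2]].

Definition ev_code (n : nat) (P : n.-tuple (F * F)) (M : set 'X_{1..2}) :
  set 'rV[F]_n := ev P @` mspan M.

Definition scale_code (n : nat) (lambda : 'rV[F]_n) (C : set 'rV[F]_n) :
  set 'rV[F]_n := [set \row_i (lambda 0 i * c 0 i) | c in C].

Definition dual_code (n : nat) (C : set 'rV[F]_n) : set 'rV[F]_n :=
  [set v | forall c, C c -> \sum_i v 0 i * c 0 i = 0].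

Definition hull (n : nat) (C : set 'rV[F]_n) : set 'rV[F]_n :=
  C `&` dual_code C.

Definition hull_multiplier (n : nat) (P : n.-tuple (F * F)) (alpha : F) :
  'rV[F]_n := \row_i (if (tnth P i).1 != 0 then alpha^-1 else 1).

End Codes.

(* Main.v *)
(* Write A = (q-1)u, N = q^(r-1), and let w = lambda^2, that is w = 1/u where
   x <> 0 and w = 1 where x = 0. For c in F_q the condition Tr(y) = c has the
   indicator 1 - (Tr(y) - c)^(q-1), and a polynomial of degree d < q^r - 1 sums
   to 0 over F; hence for b <= 2(N-1) the sum of y^b over a fiber of the trace
   does not depend on c, vanishes for b < N-1 and equals 1 for b = N-1.
   The weighted sum of x^a over the admissible abscissas (0 and the A-th roots
   of unity) vanishes for a < A and is -1 for a = A: this is where w is used,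
   to cancel the case a = 0. So the sum of w x^a y^b over the curve can be
   nonzero only if x^A y^(N-1) divides x^a y^b, and it is nonzero when these are
   equal. In other words, pairing m' with x^A y^(N-1) / m can be nonzero only if
   m divides m'. Both inclusions follow from this triangularity: the complement
   of M is orthogonal to M because M is closed under divisibility, and an
   element of the span of M orthogonal to M has no coefficient at an m in M
   whose quotient x^A y^(N-1) / m lies in M, by descending induction on m. *)

Require Import Defs.
From HB Require Import structures.
From mathcomp Require Import all_boot all_order all_algebra zify ring cyclic finfield.
From mathcomp Require Import mpoly.
From mathcomp Require Import classical_sets.

Set Implicit Arguments.
Unset Strict Implicit.
Unset Printing Implicit Defensive.

Import GRing.Theory.
Local Open Scope ring_scope.
Local Open Scope classical_set_scope.

(** * Power sums over roots of unity and over a finite field *)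

Lemma finField_has_prim_root (F : finFieldType) (n : nat) :
  (0 < n)%N -> (n %| #|F|.-1)%N -> exists z : F, n.-primitive_root z.
Proof.
move=> n_gt0 n_dv.
have F_gt1 := card_finNzRing_gt1 F.
have F_gt0 := ltnW F_gt1.
have roots : all (#|F|.-1).-unity_root [seq x <- enum F | x != 0].
  apply/allP => x; rewrite mem_filter => /andP[x0 _].
  rewrite unity_rootE -(inj_eq (mulfI x0)) -exprS prednK //.
  by rewrite expf_card mulr1.
have size_roots : (#|F|.-1 <= size [seq x <- enum F | x != 0%R])%N.
  rewrite size_filter -(leq_add2l (count (pred1 (0%R : F)) (enum F))).
  rewrite [X in (_ <= _ + X)%N](_ : _ = count (predC (pred1 (0%R : F))) (enum F)) //.
  rewrite count_predC count_uniq_mem ?enum_uniq // mem_enum inE -cardE.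
  by rewrite add1n prednK.
have F1_gt0 : (0 < #|F|.-1)%N by rewrite -subn1 subn_gt0.
have /hasP[z _ zP] := has_prim_root F1_gt0 roots
                        (filter_uniq _ (enum_uniq F)) size_roots.
by exists (z ^+ (#|F|.-1 %/ n)); apply: dvdn_prim_root.
Qed.

(** With [z] a primitive root this is a geometric sum in [z ^+ a]. Multiplied by [z ^+ a - 1] it
    telescopes to 0, and that factor vanishes only when [n] divides [a]. *)
Lemma sum_unity_root_exp (F : finFieldType) (n a : nat) :
  (0 < n)%N -> (n %| #|F|.-1)%N ->
  \sum_(x : F | x ^+ n == 1) x ^+ a = if (n %| a)%N then n%:R else 0.
Proof.
move=> n_gt0 /(finField_has_prim_root n_gt0) [z zP].
have zs_uniq : uniq [seq z ^+ i | i <- iota 0 n].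
  rewrite map_inj_in_uniq ?iota_uniq // => i j.
  rewrite !mem_iota /= add0n => i_n j_n /eqP.
  by rewrite (eq_prim_root_expr zP) !modn_small // => /eqP.
have -> : \sum_(x : F | x ^+ n == 1) x ^+ a = \sum_(i < n) (z ^+ a) ^+ i.
  transitivity (\sum_(x <- [seq z ^+ i | i <- iota 0 n]) x ^+ a).
    rewrite (big_uniq _ zs_uniq); apply: eq_bigl => x.
    apply/eqP/mapP => [/(prim_rootP zP) [i ->]|[i _ ->]].
      by exists (nat_of_ord i); rewrite // mem_iota /=.
    by rewrite exprAC (prim_expr_order zP) expr1n.
  rewrite big_map -[X in iota _ X]subn0 big_mkord.
  by apply: eq_bigr => i _; rewrite exprAC.
have za1 : (z ^+ a == 1) = (n %| a)%N by rewrite -(prim_order_dvd zP).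
case: ifP => n_a; rewrite n_a in za1.
  under eq_bigr do rewrite (eqP za1) expr1n.
  by rewrite sumr_const card_ord.
apply: (mulfI (_ : z ^+ a - 1 != 0)); first by rewrite subr_eq0 za1.
by rewrite -subrX1 exprAC (prim_expr_order zP) expr1n subrr mulr0.
Qed.

Lemma sum_finField_exp (F : finFieldType) (i : nat) :
  (i <= #|F|.-1)%N -> \sum_(y : F) y ^+ i = - (i == #|F|.-1)%:R.
Proof.
have F_gt1 := card_finNzRing_gt1 F.
have F1_gt0 : (0 < #|F|.-1)%N by rewrite -subn1 subn_gt0.
(* Translation by 1 permutes [F] and adds [#|F|] to the sum of all its elements. *)
have card0 : #|F|%:R = 0 :> F.
  apply: (addrI (\sum_(y : F) y)); rewrite addr0.
  rewrite [RHS](reindex_inj (addIr 1)) big_split /=.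
  by rewrite sumr_const; congr (_ + _).
(* The exponent 0 is separate because 0 ^ 0 = 1: the term at 0 then counts, and the total is [#|F|]
   = 0. *)
case: (posnP i) => [-> _|i_gt0 i_le].
  under eq_bigr do rewrite expr0.
  by rewrite sumr_const (ltn_eqF F1_gt0) oppr0 card0.
have unitE (y : F) : (y ^+ #|F|.-1 == 1) = (y != 0).
  have [->|y0] := eqVneq y 0; first by rewrite expr0n gtn_eqF // eq_sym oner_eq0.
  by rewrite -(inj_eq (mulfI y0)) -exprS prednK ?(ltnW F_gt1) // expf_card mulr1 eqxx.
rewrite (bigD1 0) //= expr0n gtn_eqF // add0r.
under eq_bigl do rewrite -unitE.
rewrite sum_unity_root_exp //.
move: i_le; rewrite leq_eqVlt => /predU1P[->|i_lt].
  rewrite dvdnn eqxx; apply/eqP; rewrite -addr_eq0 -natrD addn1 prednK ?card0 //.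
  exact: ltnW.
by rewrite (ltn_eqF i_lt) oppr0 gtnNdvd.
Qed.

Lemma sum_finField_horner (F : finFieldType) (p : {poly F}) :
  (size p <= #|F|)%N -> \sum_(y : F) p.[y] = - p`_#|F|.-1.
Proof.
have F_gt0 := ltnW (card_finNzRing_gt1 F).
rewrite -{1}(prednK F_gt0) => p_le.
under eq_bigr do rewrite (horner_coef_wide _ p_le).
rewrite exchange_big /= big_ord_recr /= big1 ?add0r => [|i _].
  by rewrite -mulr_sumr sum_finField_exp // eqxx mulrN1.
by rewrite -mulr_sumr sum_finField_exp ?ltn_eqF ?oppr0 ?mulr0 // ltnW.
Qed.

(** * The trace polynomial and power sums over its fibers *)

Definition trace_polynomial (F : fieldType) (q r : nat) : {poly F} :=
  \sum_(k < r) 'X^(q ^ k).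

Lemma horner_trace_polynomial (F : fieldType) (q r : nat) (y : F) :
  (trace_polynomial F q r).[y] = trace_poly q r y.
Proof. by rewrite horner_sum; apply: eq_bigr => k _; rewrite hornerXn. Qed.

Lemma trace_polynomial_lead (F : fieldType) (q r : nat) :
  (1 < q)%N -> (0 < r)%N ->
  size (trace_polynomial F q r) = (q ^ r.-1).+1
  /\ trace_polynomial F q r \is monic.
Proof.
move=> q_gt1; case: r => // r _.
have low : (size (\sum_(k < r) 'X^(q ^ k) : {poly F})%R < (q ^ r).+1)%N.
  rewrite ltnS; apply: (leq_trans (size_sum _ _ _)).
  by apply/bigmax_leqP => k _; rewrite size_polyXn ltn_exp2l.
rewrite /trace_polynomial big_ord_recr /= addrC monicE.
by split; [rewrite size_polyDl | rewrite lead_coefDl];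
  rewrite ?size_polyXn ?lead_coefXn.
Qed.

Lemma prime_power_gt1 (q : nat) : prime_power q -> (1 < q)%N.
Proof.
move=> [p [k [p_pr k_gt0 ->]]].
by rewrite -(exp1n k) ltn_exp2r // prime_gt1.
Qed.

Lemma prime_power_pnat (q r : nat) (F : finFieldType) :
  prime_power q -> (0 < r)%N -> #|F| = (q ^ r)%N -> [pchar F].-nat q.
Proof.
move=> [p [k [p_pr k_gt0 qE]]] r_gt0 hF.
have pF : p \in [pchar F].
  by apply: (@card_finPcharP _ _ (k * r)%N) => //; rewrite expnM -qE.
by rewrite qE (eq_pnat _ (pcharf_eq pF)) pnatX pnat_id.
Qed.

Lemma prime_power_natr0 (q r : nat) (F : finFieldType) :
  prime_power q -> (0 < r)%N -> #|F| = (q ^ r)%N -> q%:R = 0 :> F.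
Proof.
move=> [p [k [p_pr k_gt0 qE]]] r_gt0 hF.
have pF : p \in [pchar F].
  by apply: (@card_finPcharP _ _ (k * r)%N) => //; rewrite expnM -qE.
by rewrite qE natrX pcharf0 // expr0n gtn_eqF.
Qed.

(** Raising to the power q shifts the terms cyclically, the last one becoming y ^ (q ^ r) = y. *)
Lemma trace_poly_frobenius (q r : nat) (F : finFieldType) (y : F) :
  prime_power q -> (0 < r)%N -> #|F| = (q ^ r)%N ->
  trace_poly q r y ^+ q = trace_poly q r y.
Proof.
move=> hq; case: r => // r r_gt0 hF.
have qF := prime_power_pnat hq r_gt0 hF.
have sumX (s : seq nat) (f : nat -> F) :
  (\sum_(i <- s) f i) ^+ q = \sum_(i <- s) f i ^+ q.
  elim: s => [|i s IHs]; last by rewrite !big_cons exprDn_pchar // IHs.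
  by rewrite !big_nil expr0n gtn_eqF // ltnW // prime_power_gt1.
rewrite /trace_poly -(big_mkord xpredT (fun k => y ^+ (q ^ k))) sumX.
transitivity (\sum_(0 <= k < r.+1) y ^+ (q ^ k.+1)).
  by apply: eq_bigr => i _; rewrite -exprM -expnSr.
rewrite big_nat_recr //= big_nat_recl //= -hF expf_card.
by rewrite addrC expn0 expr1.
Qed.

(** The difference t of two elements fixed by the q-th power satisfies t ^ q = t, so t ^ (q - 1) is
    1 unless t = 0. *)
Lemma trace_fiber_indicator (q r : nat) (F : finFieldType) (c y : F) :
  prime_power q -> (0 < r)%N -> #|F| = (q ^ r)%N -> c ^+ q = c ->
  1 - (trace_poly q r y - c) ^+ (q - 1) = (c == trace_poly q r y)%:R.
Proof.
move=> hq r_gt0 hF cq.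
have q_gt1 := prime_power_gt1 hq.
have := exprDn_pchar (trace_poly q r y - c) c (prime_power_pnat hq r_gt0 hF).
rewrite subrK cq trace_poly_frobenius // => e.
have tE : (trace_poly q r y - c) ^+ q = trace_poly q r y - c.
  exact: canRL (addrK c) (esym e).
have [->|neq] := eqVneq c (trace_poly q r y).
  by rewrite subrr expr0n subn_eq0 leqNgt q_gt1 subr0.
have t0 : trace_poly q r y - c != 0 by rewrite subr_eq0 eq_sym.
apply/eqP; rewrite subr_eq0 eq_sym -(inj_eq (mulfI t0)) -exprS.
by rewrite subn1 prednK ?(ltnW q_gt1) // tE mulr1.
Qed.

(** The right-hand side is the indicator sum at c = 0. The bound on [b] leaves room for the product
    of two monomials of y-degree at most q ^ (r - 1) - 1. *)
Lemma sum_trace_fiber (q r : nat) (F : finFieldType) (c : F) (b : nat) :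
  prime_power q -> (0 < r)%N -> #|F| = (q ^ r)%N -> c ^+ q = c ->
  (b <= 2 * (q ^ r.-1 - 1))%N ->
  \sum_(y : F | c == trace_poly q r y) y ^+ b =
  \sum_(y : F) y ^+ b * (1 - trace_poly q r y ^+ (q - 1)).
Proof.
move=> hq r_gt0 hF cq b_le.
have q_gt1 := prime_power_gt1 hq.
have [sizeT _] := trace_polynomial_lead F q_gt1 r_gt0.
set T := trace_polynomial F q r in sizeT.
pose N := (q ^ r.-1)%N; rewrite -/N in b_le sizeT.
have cardF : #|F| = (q * N)%N by rewrite hF -expnS prednK.
have N_gt0 : (0 < N)%N by rewrite expn_gt0 ltnW.
(* b + deg d < q^r - 1, so d contributes nothing to the power sum over F. *)
pose d := (T - c%:P) ^+ (q - 1) - T ^+ (q - 1).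
have size_d : (size d <= ((q - 2) * N).+1)%N.
  (* Factoring the difference of powers isolates the constant [- c], which lowers the degree bound
     from (q - 1) N to (q - 2) N. *)
  rewrite /d subrXX.
  have -> : T - c%:P - T = (- c)%:P by rewrite polyCN addrAC subrr add0r.
  rewrite mul_polyC; apply: (leq_trans (size_scale_leq _ _)).
  apply: (leq_trans (size_sum _ _ _)); apply/bigmax_leqP => i _.
  have sizeTc : (size (T - c%:P)%R <= N.+1)%N.
    rewrite (leq_trans (size_polyD _ _)) // geq_max sizeT leqnn size_polyN.
    exact: leq_trans (size_polyC_leq1 _) _.
  apply: (leq_trans (size_polyMleq _ _)).
  have s1 := size_poly_exp_leq (T - c%:P) ((q - 1).-1 - i).
  have s2 := size_poly_exp_leq T i.
  have {}s1 : (size ((T - c%:P) ^+ ((q - 1).-1 - i))%R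
               <= (N * ((q - 1).-1 - i)).+1)%N.
    by apply: (leq_trans s1); rewrite ltnS leq_mul2r; apply/orP; right; lia.
  rewrite sizeT /= in s2.
  have iq : ((q - 2) * N = N * ((q - 1).-1 - i) + N * i)%N.
    by rewrite -mulnDr mulnC; congr (_ * _)%N; have := ltn_ord i; lia.
  rewrite -subn1 leq_subLR iq.
  apply: leq_trans (leq_add s1 s2) _.
  by rewrite addSn addnS add1n.
have sum_d : \sum_(y : F) ('X^b * d).[y] = 0.
  have s : (size ('X^b * d)%R <= #|F|.-1)%N.
    apply: (leq_trans (size_polyMleq _ _)); rewrite size_polyXn cardF.
    have -> : (q * N = (q - 2) * N + 2 * N)%N by rewrite -mulnDl subnK.
    move: size_d b_le N_gt0; clear; move: (size d) ((q - 2) * N)%N => s e; lia.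
  rewrite sum_finField_horner; last by rewrite (leq_trans s) // leq_pred.
  by rewrite nth_default // oppr0.
rewrite big_mkcond -[RHS]subr0 -[X in _ = _ - X]sum_d -sumrB; apply: eq_bigr => y _.
rewrite /d !hornerE horner_trace_polynomial.
transitivity (y ^+ b * (c == trace_poly q r y)%:R).
  by case: eqP => _; rewrite ?mulr1 ?mulr0.
by rewrite -(trace_fiber_indicator _ hq r_gt0 hF cq) -mulrBr opprB addrA subrK.
Qed.

(** The power y ^ b alone sums to 0. The product with the trace power is monic of degree b + (q - 1)
    N, which reaches [#|F|.-1] only for b = N - 1; its leading coefficient 1 is then the whole
    sum. *)
Lemma sum_trace_fiber_le (q r : nat) (F : finFieldType) (b : nat) :
  prime_power q -> (1 < r)%N -> #|F| = (q ^ r)%N ->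
  (b <= q ^ r.-1 - 1)%N ->
  \sum_(y : F) y ^+ b * (1 - trace_poly q r y ^+ (q - 1)) =
  (b == q ^ r.-1 - 1)%N%:R.
Proof.
move=> hq r_gt1 hF b_le.
have r_gt0 := ltnW r_gt1.
have q_gt1 := prime_power_gt1 hq.
have [sizeT monicT] := trace_polynomial_lead F q_gt1 r_gt0.
set T := trace_polynomial F q r in sizeT monicT.
pose N := (q ^ r.-1)%N; rewrite -/N in b_le sizeT *.
have cardF : #|F| = (q * N)%N by rewrite hF -expnS prednK.
have N_gt0 : (0 < N)%N by rewrite expn_gt0 ltnW.
have cardE : #|F|.-1 = (N - 1 + (q - 1) * N)%N.
  by rewrite cardF -{1}(subnK (ltnW q_gt1)) mulnDl mul1n; lia.
have N_le : (0 < (q - 1) * N)%N by rewrite muln_gt0 subn_gt0 q_gt1.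
have monicE : 'X^b * T ^+ (q - 1) \is monic by rewrite rpredM ?monicXn ?rpredX.
have sizeE : size ('X^b * T ^+ (q - 1)) = (b + (q - 1) * N).+1.
  rewrite size_Mmonic ?monic_neq0 ?monicXn ?rpredX //.
  have Tpos : (0 < size (T ^+ (q - 1)))%N.
    by rewrite size_poly_gt0 monic_neq0 ?rpredX.
  by rewrite size_polyXn addSn /= -(prednK Tpos) size_exp sizeT mulnC addnS.
transitivity (\sum_(y : F) y ^+ b - \sum_(y : F) ('X^b * T ^+ (q - 1)).[y]).
  rewrite -sumrB; apply: eq_bigr => y _.
  by rewrite mulrBr mulr1 !hornerE horner_trace_polynomial.
rewrite sum_finField_exp ?sum_finField_horner; last 2 first.
- by rewrite sizeE; lia.
- by lia.
rewrite ltn_eqF; last by lia.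
rewrite oppr0 sub0r opprK.
have [bE|b_neq] := eqVneq b (N - 1)%N.
  by move: (monicP monicE); rewrite lead_coefE sizeE cardE bE.
by rewrite nth_default // sizeE; lia.
Qed.

(** * Weighted power sums over the abscissas *)

Lemma dvdn_norm_exponent (q r u : nat) :
  (1 < q)%N -> (u %| (q ^ r - 1) %/ (q - 1))%N ->
  ((q - 1) * u %| (q ^ r).-1)%N.
Proof.
move=> q_gt1; have q1_gt0 : (0 < q - 1)%N by rewrite subn_gt0.
rewrite !subn1 predn_exp -subn1 mulKn // => u_dv.
by rewrite dvdn_pmul2l.
Qed.

(** The integer q ^ r - 1 is -1 in [F], so none of its divisors vanishes there. *)
Lemma dvd_natr_neq0 (q r u : nat) (F : finFieldType) :
  prime_power q -> (0 < r)%N -> #|F| = (q ^ r)%N ->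
  (u %| (q ^ r).-1)%N -> u%:R != 0 :> F.
Proof.
move=> hq r_gt0 hF /dvdnP[k kE]; apply/eqP => u0.
have := prime_power_natr0 hq r_gt0 hF.
have /(congr1 (fun m => m%:R : F)) : ((q ^ r).-1 + 1 = q ^ r)%N.
  by rewrite addn1 prednK // expn_gt0 ltnW ?prime_power_gt1.
rewrite kE natrD natrM u0 mulr0 add0r natrX => e q0.
by move/eqP: e; rewrite q0 expr0n gtn_eqF // oner_eq0.
Qed.

(** The square of the hull multiplier: pairing two scaled words brings the multiplier in twice. *)
Definition abscissa_weight (F : fieldType) (alpha x : F) : F :=
  (if x != 0 then alpha^-1 else 1) ^+ 2.

Lemma sum_abscissa_weight (q r u : nat) (F : finFieldType) (alpha : F)
    (a : nat) :
  prime_power q -> (0 < r)%N -> #|F| = (q ^ r)%N ->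
  (0 < u)%N -> (u %| (q ^ r - 1) %/ (q - 1))%N -> alpha ^+ 2 = u%:R ->
  (a <= (q - 1) * u)%N ->
  \sum_(x : F | x ^+ u ^+ q == x ^+ u) abscissa_weight alpha x * x ^+ a =
  - (a == (q - 1) * u)%N%:R.
Proof.
move=> hq r_gt0 hF u_gt0 hu halpha.
have q_gt1 := prime_power_gt1 hq.
have A_dv := dvdn_norm_exponent q_gt1 hu.
set A := ((q - 1) * u)%N in A_dv * => a_le.
have A_gt0 : (0 < A)%N by rewrite muln_gt0 subn_gt0 q_gt1.
have u0 : u%:R != 0 :> F.
  by apply: (dvd_natr_neq0 hq r_gt0 hF); apply: dvdn_trans A_dv; apply: dvdn_mull.
(* The number of [A]-th roots of unity is -u in [F], which the weight 1/u turns into -1. *)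
have natrA : A%:R = - u%:R :> F.
  rewrite natrM natrB ?(ltnW q_gt1) // (prime_power_natr0 hq r_gt0 hF).
  by rewrite sub0r mulN1r.
rewrite (bigD1 0) /=; last by rewrite !expr0n gtn_eqF // expr0n gtn_eqF // ltnW.
rewrite {1}/abscissa_weight eqxx expr1n mul1r expr0n.
have -> : \sum_(x : F | (x ^+ u ^+ q == x ^+ u) && (x != 0))
            abscissa_weight alpha x * x ^+ a =
          u%:R^-1 * \sum_(x : F | x ^+ A == 1) x ^+ a.
  rewrite mulr_sumr; apply: eq_big => [x|x /andP[_ x0]]; last first.
    by rewrite /abscissa_weight x0 exprVn halpha.
  have [->|x0] := eqVneq x 0.
    by rewrite andbF expr0n gtn_eqF // eq_sym oner_eq0.
  have xu0 : x ^+ u != 0 by rewrite expf_neq0.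
  rewrite andbT -(inj_eq (mulfI xu0) (x ^+ A)) mulr1 /A mulnC exprM.
  by rewrite -exprS subn1 prednK // ltnW.
rewrite sum_unity_root_exp ?hF // natrA.
(* For a = 0 the abscissa 0 contributes 1 and the roots of unity contribute -1. *)
have [->|a_gt0] := posnP a.
  by rewrite dvdn0 mulrN mulVf // subrr (ltn_eqF A_gt0) oppr0.
rewrite add0r; have [->|a_neq] := eqVneq a A.
  by rewrite dvdnn mulrN mulVf.
by rewrite gtnNdvd ?mulr0 ?oppr0 // ltn_neqAle a_neq.
Qed.

(** * Moments over the points of the curve *)

Lemma sum_norm_trace_points (q r u : nat) (F : finFieldType) (n : nat)
    (P : n.-tuple (F * F)) (G : F -> F -> F) :
  uniq P -> [set` P] = norm_trace_points q r u ->
  \sum_(i < n) G (tnth P i).1 (tnth P i).2 =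
  \sum_(x : F) \sum_(y : F | x ^+ u == trace_poly q r y) G x y.
Proof.
move=> Puniq hP.
rewrite -(big_tuple _ _ P xpredT (fun z => G z.1 z.2)) (big_uniq _ Puniq) /=.
rewrite pair_big_dep /=; apply: eq_bigl => -[x y] /=.
have : [set` P] (x, y) = norm_trace_points q r u (x, y) by rewrite hP.
by rewrite /norm_trace_points /= => e; apply/idP/eqP; rewrite e.
Qed.

(** The pairing of the scaled evaluations of two monomials whose product is x^a y^b. *)
Definition point_moment (F : fieldType) (n : nat) (P : n.-tuple (F * F))
    (alpha : F) (a b : nat) : F :=
  \sum_(i < n) abscissa_weight alpha (tnth P i).1 *
    (tnth P i).1 ^+ a * (tnth P i).2 ^+ b.

Lemma point_moment_split (q r u : nat) (F : finFieldType) (n : nat)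
    (P : n.-tuple (F * F)) (alpha : F) (a b : nat) :
  prime_power q -> (0 < r)%N -> #|F| = (q ^ r)%N ->
  uniq P -> [set` P] = norm_trace_points q r u ->
  (b <= 2 * (q ^ r.-1 - 1))%N ->
  point_moment P alpha a b =
  (\sum_(x : F | x ^+ u ^+ q == x ^+ u) abscissa_weight alpha x * x ^+ a) *
  \sum_(y : F) y ^+ b * (1 - trace_poly q r y ^+ (q - 1)).
Proof.
move=> hq r_gt0 hF Puniq hP b_le.
rewrite /point_moment (sum_norm_trace_points
  (fun x y => abscissa_weight alpha x * x ^+ a * y ^+ b) Puniq hP).
rewrite mulr_suml [RHS]big_mkcond; apply: eq_bigr => x _.
rewrite -mulr_sumr; case: eqP => [xq|xq].
  by rewrite (sum_trace_fiber hq r_gt0 hF xq b_le).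
(* Traces are fixed by the q-th power, so the fiber over any other abscissa is empty. *)
rewrite big_pred0 ?mulr0 // => y; apply/eqP => xy; case: xq.
by rewrite xy trace_poly_frobenius.
Qed.

Lemma point_moment_neq0 (q r u : nat) (F : finFieldType) (n : nat)
    (P : n.-tuple (F * F)) (alpha : F) (a b : nat) :
  prime_power q -> (1 < r)%N -> #|F| = (q ^ r)%N ->
  (0 < u)%N -> (u %| (q ^ r - 1) %/ (q - 1))%N -> alpha ^+ 2 = u%:R ->
  uniq P -> [set` P] = norm_trace_points q r u ->
  (b <= 2 * (q ^ r.-1 - 1))%N -> point_moment P alpha a b != 0 ->
  ((q - 1) * u <= a)%N && (q ^ r.-1 - 1 <= b)%N.
Proof.
move=> hq r_gt1 hF u_gt0 hu halpha Puniq hP b_le.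
have r_gt0 := ltnW r_gt1.
rewrite (point_moment_split _ _ hq r_gt0 hF Puniq hP b_le) mulf_eq0.
case/norP => x_neq0 y_neq0; apply/andP; split; rewrite leqNgt.
  apply: contraNN x_neq0 => lt.
  by rewrite (sum_abscissa_weight hq r_gt0 hF) ?(ltn_eqF lt) ?oppr0 // ltnW.
apply: contraNN y_neq0 => lt.
by rewrite sum_trace_fiber_le ?(ltn_eqF lt) // ltnW.
Qed.

Lemma point_moment_top (q r u : nat) (F : finFieldType) (n : nat)
    (P : n.-tuple (F * F)) (alpha : F) :
  prime_power q -> (1 < r)%N -> #|F| = (q ^ r)%N ->
  (0 < u)%N -> (u %| (q ^ r - 1) %/ (q - 1))%N -> alpha ^+ 2 = u%:R ->
  uniq P -> [set` P] = norm_trace_points q r u ->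
  point_moment P alpha ((q - 1) * u) (q ^ r.-1 - 1) = - 1.
Proof.
move=> hq r_gt1 hF u_gt0 hu halpha Puniq hP.
have r_gt0 := ltnW r_gt1.
rewrite (point_moment_split _ _ hq r_gt0 hF Puniq hP); last by rewrite leq_pmull.
rewrite (sum_abscissa_weight hq r_gt0 hF) // eqxx.
by rewrite sum_trace_fiber_le // eqxx mulr1.
Qed.

(** * Spans of monomials and the pairing of their evaluations *)

Lemma mspanP (F : fieldType) (M : set 'X_{1..2}) (f : {mpoly F[2]}) :
  mspan M f <-> forall m, m \in msupp f -> M m.
Proof.
split=> [[s [c [sM ->]]] m|fM]; last first.
  by exists (msupp f), (fun m => f@_m); split=> //; exact: mpolyE.
rewrite mcoeff_msupp; have [/sM //|ms] := boolP (m \in s).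
rewrite raddf_sum big_seq big1 ?eqxx //= => k ks.
rewrite mcoeffZ mcoeffX; case: eqP => [km|_]; last by rewrite mulr0.
by rewrite -km ks in ms.
Qed.

Lemma ev_msupp (F : fieldType) (n : nat) (P : n.-tuple (F * F))
    (f : {mpoly F[2]}) (i : 'I_n) :
  ev P f 0 i = \sum_(m <- msupp f)
    f@_m * ((tnth P i).1 ^+ m ord0 * (tnth P i).2 ^+ m ord_max).
Proof.
rewrite mxE {1}[f]mpolyE raddf_sum; apply: eq_bigr => m _ /=.
rewrite mevalZ mevalX big_ord_recl big_ord1.
by rewrite (_ : lift ord0 ord0 = ord_max) //; apply: val_inj.
Qed.

Lemma dual_pairing (F : fieldType) (n : nat) (P : n.-tuple (F * F))
    (alpha : F) (f g : {mpoly F[2]}) :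
  \sum_(i < n) (\row_j (hull_multiplier P alpha 0 j * ev P f 0 j)) 0 i *
               (\row_j (hull_multiplier P alpha 0 j * ev P g 0 j)) 0 i =
  \sum_(m <- msupp f) \sum_(m' <- msupp g) f@_m * g@_m' *
    point_moment P alpha (m ord0 + m' ord0) (m ord_max + m' ord_max).
Proof.
transitivity (\sum_(i < n) \sum_(m <- msupp f) \sum_(m' <- msupp g)
    f@_m * g@_m' * (abscissa_weight alpha (tnth P i).1 *
      (tnth P i).1 ^+ (m ord0 + m' ord0) *
      (tnth P i).2 ^+ (m ord_max + m' ord_max))).
  apply: eq_bigr => i _.
  have := ev_msupp P f i; have := ev_msupp P g i; rewrite !mxE => -> ->.
  rewrite mulrACA big_distrlr mulr_sumr.
  apply: eq_bigr => m _; rewrite mulr_sumr; apply: eq_bigr => m' _.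
  rewrite /= /abscissa_weight !exprD; move: (if _ then _ else _) => w; ring.
rewrite exchange_big; apply: eq_bigr => m _.
rewrite exchange_big; apply: eq_bigr => m' _.
by rewrite -mulr_sumr.
Qed.

Lemma ord2P (k : 'I_2) : k = ord0 \/ k = ord_max.
Proof. by case: k => [[|[|k]] hk] //; [left | right]; apply: val_inj. Qed.

Lemma mnm2_le (m m' : 'X_{1..2}) :
  (m <= m')%MM = (m ord0 <= m' ord0)%N && (m ord_max <= m' ord_max)%N.
Proof.
apply/mnm_lepP/andP => [le | [le0 le1] k]; first by split.
by case: (ord2P k) => ->.
Qed.

Lemma mnm2_eq (m m' : 'X_{1..2}) :
  m ord0 = m' ord0 -> m ord_max = m' ord_max -> m = m'.
Proof. by move=> e0 e1; apply/mnmP => k; case: (ord2P k) => ->. Qed.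

Lemma DeltaE (i j : nat) (m : 'X_{1..2}) :
  Delta i j m <-> (m ord0 < i)%N /\ (m ord_max < j)%N.
Proof.
by rewrite /Delta /= !mnm2_le !multinomE !(tnth_nth 0%N) /= andbT -!ltnNge.
Qed.

Theorem theorem5p3 (q r u : nat) (F : finFieldType)
    (hq : prime_power q) (hr : (2 <= r)%N)
    (hF : #|F| = (q ^ r)%N)
    (hu0 : (0 < u)%N) (hu : (u %| (q ^ r - 1) %/ (q - 1))%N)
    (n : nat) (P : n.-tuple (F * F)) (hPuniq : uniq P)
    (hP : [set` P] = norm_trace_points q r u)
    (M : set 'X_{1..2})
    (hMsub : M `<=` Delta ((q - 1) * u + 1) (q ^ (r - 1)))
    (hMdiv : div_closed M)
    (alpha : F) (halpha : alpha ^+ 2 = u%:R) :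
  hull (scale_code (hull_multiplier P alpha) (ev_code P M)) =
  scale_code (hull_multiplier P alpha) (ev_code P (M `&` mcompl q r u M)).
Proof.
set lam := hull_multiplier P alpha.
set A := ((q - 1) * u)%N in hMsub *.
pose N1 := (q ^ (r - 1) - 1)%N.
pose top := mon A N1.
have N_gt0 : (0 < q ^ (r - 1))%N by rewrite expn_gt0 ltnW ?prime_power_gt1.
have inDelta (m : 'X_{1..2}) : Delta (A + 1) (q ^ (r - 1)) m <->
    (m ord0 <= A)%N /\ (m ord_max <= N1)%N.
  rewrite DeltaE addn1 ltnS; split=> -[? ?]; split=> //.
    by rewrite /N1 subn1 -ltnS prednK.
  by rewrite -(prednK N_gt0) ltnS -subn1.
have quot0 m : (top - m)%MM ord0 = (A - m ord0)%N.
  by rewrite mnmBE multinomE (tnth_nth 0%N).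
have quot1 m : (top - m)%MM ord_max = (N1 - m ord_max)%N.
  by rewrite mnmBE multinomE (tnth_nth 0%N).
have quot_Delta m : Delta (A + 1) (q ^ (r - 1)) (top - m)%MM.
  by apply/inDelta; rewrite quot0 quot1 !leq_subr.
(* Within [Delta] the subtraction from [top] is never truncated, so it is an involution. *)
have quotK m : Delta (A + 1) (q ^ (r - 1)) m -> (top - (top - m))%MM = m.
  move=> /inDelta[le0 le1].
  by apply: mnm2_eq; rewrite ?quot0 ?quot1 subKn.
(* Both y-exponents are at most [N1], so their sum is in the range of the fiber sums. The exponents
   of m' + (top - m) reach those of [top] exactly when m divides m'. *)
have moment_le m m' : Delta (A + 1) (q ^ (r - 1)) m ->
    Delta (A + 1) (q ^ (r - 1)) m' ->
    point_moment P alpha (m' ord0 + (top - m)%MM ord0)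
      (m' ord_max + (top - m)%MM ord_max) != 0 -> (m <= m')%MM.
  move=> /inDelta[m0 m1] /inDelta[m'0 m'1]; rewrite quot0 quot1.
  move/(point_moment_neq0 hq hr hF hu0 hu halpha hPuniq hP).
  rewrite mnm2_le -[r.-1]subn1 -/A -/N1 => /(_ _)/andP[]; lia.
have moment_top : point_moment P alpha A N1 != 0.
  have := point_moment_top hq hr hF hu0 hu halpha hPuniq hP.
  by rewrite -[r.-1]subn1 => ->; rewrite oppr_eq0 oner_eq0.
pose bform (f g : {mpoly F[2]}) := \sum_(m <- msupp f) \sum_(m' <- msupp g)
  f@_m * g@_m' *
  point_moment P alpha (m ord0 + m' ord0) (m ord_max + m' ord_max).
(* Pairing f with top / m only sees the coefficients of f at multiples of m. *)
have coef0 f : mspan M f -> (forall g, mspan M g -> bform f g = 0) ->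
    forall m, M m -> M (top - m)%MM -> f@_m = 0.
  (* The induction is on the degree of [top - m], so proper multiples of [m] are treated first. *)
  move=> /mspanP fM f_orth m; have [k] := ubnP (A - m ord0 + (N1 - m ord_max)).
  elim: k m => // k IHk m; rewrite ltnS => m_k Mm Mquot.
  apply/eqP/negPn/negP => fm; have /inDelta[m0 m1] := hMsub _ Mm.
  have Xquot : mspan M ('X_[(top - m)%MM] : {mpoly F[2]}).
    by apply: (mspanP M _).2 => m'; rewrite msuppX inE => /eqP->.
  have := f_orth _ Xquot; rewrite /bform.
  under eq_bigr do rewrite msuppX big_seq1 mcoeffX eqxx mulr1.
  rewrite (bigD1_seq m) ?mcoeff_msupp ?msupp_uniq //=.
  rewrite big_seq_cond big1 => [|m' /andP[fm' m'_neq]].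
    rewrite quot0 quot1 !subnKC // addr0 => /eqP.
    by rewrite mulf_eq0 (negPf fm) (negPf moment_top).
  have Mm' := fM _ fm'; have /inDelta[m'0 m'1] := hMsub _ Mm'.
  have [->|] := eqVneq (point_moment P alpha (m' ord0 + (top - m)%MM ord0)
    (m' ord_max + (top - m)%MM ord_max)) 0; first by rewrite mulr0.
  move=> /(moment_le _ _ (hMsub _ Mm) (hMsub _ Mm')) m_le.
  move: (m_le); rewrite mnm2_le => /andP[le0 le1].
  (* As [m] divides [m'], [top - m'] divides [top - m] and lies in [M] by closure; the induction
     hypothesis then kills the coefficient at [m']. *)
  rewrite IHk ?mul0r //; last first.
    by apply: hMdiv Mquot _; rewrite mnm2_le !quot0 !quot1 !leq_sub2l.
  have : ~ (m ord0 = m' ord0 /\ m ord_max = m' ord_max).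
    by case=> e0 e1; case/eqP: m'_neq; apply: mnm2_eq.
  move: m0 m1 m'0 m'1 le0 le1 m_k; clear.
  by move: (m ord0) (m ord_max) (m' ord0) (m' ord_max) (A) (N1); lia.
have dual_f f : dual_code (scale_code lam (ev_code P M))
      (\row_i (lam 0 i * ev P f 0 i)) <->
    forall g, mspan M g -> bform f g = 0.
  split=> [f_dual g gM | f_orth _ [_ [g gM <-] <-]].
    rewrite /bform -dual_pairing; apply: f_dual.
    by exists (ev P g) => //; exists g.
  by rewrite dual_pairing; apply: f_orth.
apply/seteqP; split => v.
  move=> [[_ [f fM <-] <-] /dual_f f_orth].
  exists (ev P f) => //; exists f => //; apply/mspanP => m fm.
  have Mm := (mspanP M f).1 fM m fm; split=> //.
  (* The witness [top - m] must lie outside [M]: otherwise [coef0] would remove [m] from the support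
     of [f]. *)
  exists (top - m)%MM; last by apply: quotK; apply: hMsub.
  split=> // Mquot; move: fm; rewrite mcoeff_msupp.
  by rewrite (coef0 _ fM f_orth _ Mm Mquot) eqxx.
move=> [_ [f fMM <-] <-]; have {}fMM := (mspanP _ f).1 fMM.
split; first by exists (ev P f) => //; exists f => //; apply/mspanP => m /fMM[].
apply/dual_f => g /mspanP gM.
rewrite /bform big_seq big1 // => m /fMM[Mm [m0 [m0_Delta nMm0] <-]].
rewrite big_seq big1 // => m' /gM Mm'.
apply/eqP; rewrite mulf_eq0; apply/orP; right.
(* Here [m] is [top - m0] with [m0] outside [M]. A nonzero moment would make [m0] divide [m'], and
   closure would put [m0] in [M]. *)
apply: contraT; rewrite addnC [X in point_moment _ _ _ X]addnC.
move=> /(moment_le _ _ m0_Delta (hMsub _ Mm')) m0_le.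
by case: nMm0; apply: hMdiv Mm' m0_le.
Qed.
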